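(* Let $\hat v\in\mathbb{C}^{3N}$ be a given solution to the load-flow equations with power injection $\hat s\in\mathbb{C}^{6N}$ satisfying $$\xi(\hat s)<(\gamma(\hat v))^2 .$$ Let $s\in\mathbb{C}^{6N}$ be another power injection vector, and assume that $$\xi(s-\hat s)<\frac14\left(\frac{(\gamma(\hat v))^2-\xi(\hat s)}{\gamma(\hat v)}\right)^2 .$$ Let $$\rho^\ddagger:=\frac12\left(\frac{(\gamma(\hat v))^2-\xi(\hat s)}{\gamma(\hat v)}\right),\qquad \rho^\dagger:=\rho^\ddagger-\sqrt{(\rho^\ddagger)^2-\xi(s-\hat s)} ,$$ and for $\rho\ge 0$ let $\mathcal{D}_\rho(\hat v)=\{v\in\mathbb{C}^{3N}:\ |(v)_j-(\hat v)_j|\le\rho\,|(w)_j|,\ j=1,\dots,3N\}$. Then: (i) The operating point $(\hat v,\hat s)$ is non-singular. (ii) There exists a unique solution $v$ in $\mathcal{D}_{\rho^\ddagger}(\hat v)$ to the load-flow equations with power injection $s$. (iii) This solution is reached by the iteration $v^{(k+1)}=G_s(v^{(k)})$ starting from anywhere in $\mathcal{D}_{\rho^\ddagger}(\hat v)$, i.e. for every $v^{(0)}\in\mathcal{D}_{\rho^\ddagger}(\hat v)$ the iterates converge to $v$. (iv) The solution $v$ is located in $\mathcal{D}_{\rho^\dagger}(\hat v)$. (v) The pair $(v,s)$ satisfies $\xi(s)<(\gamma(v))^2$; hence, it is non-singular.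
   Context: Network data. Let $N\ge 1$ be an integer (number of three-phase $PQ$ buses). Let $Y_{L0}\in\mathbb{C}^{3N\times 3}$ and $Y_{LL}\in\mathbb{C}^{3N\times 3N}$ be the blocks of the three-phase admittance matrix $Y=\begin{pmatrix}Y_{00}&Y_{0L}\\ Y_{L0}&Y_{LL}\end{pmatrix}\in\mathbb{C}^{3(N+1)\times 3(N+1)}$, and let $v_0\in\mathbb{C}^3$ be the (fixed, known) slack-bus voltage vector. It is assumed that $Y_{LL}$ is invertible. Put $w:=-Y_{LL}^{-1}Y_{L0}v_0\in\mathbb{C}^{3N}$ (zero-load voltage); all entries of $w$ are assumed nonzero. Put $W:=\mathrm{diag}(w)$. Let $H\in\mathbb{R}^{3N\times 3N}$ be the block-diagonal matrix with $N$ diagonal blocks all equal to $$\Gamma=\begin{pmatrix}1&-1&0\\0&1&-1\\-1&0&1\end{pmatrix},$$ and let $L:=|H|$ be its entrywise absolute value. Conventions. $|\cdot|$ of a vector or matrix is entrywise; $\overline{\,\cdot\,}$ is (entrywise) complex conjugation; $^{\mathsf T}$ is transposition; $\mathrm{diag}(x)$ is the diagonal matrix with diagonal $x$; $\|A\|_\infty=\max_i\sum_j|A_{ij}|$ for a complex matrix $A$; $(x)_j$ is the $j$-th entry of $x$. A vector of power injections is $s=((s^Y)^{\mathsf T},(s^\Delta)^{\mathsf T})^{\mathsf T}\in\mathbb{C}^{6N}$ with $s^Y,s^\Delta\in\mathbb{C}^{3N}$. Load-flow equations. A vector $v\in\mathbb{C}^{3N}$ is a solution to the load-flow equations with power injection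 $s$ if there are $i,i^\Delta\in\mathbb{C}^{3N}$ such that $$\mathrm{diag}(H^{\mathsf T}\overline{i^\Delta})\,v+s^Y=\mathrm{diag}(v)\,\overline{i},\qquad s^\Delta=\mathrm{diag}(Hv)\,\overline{i^\Delta},\qquad i=Y_{L0}v_0+Y_{LL}v .$$ When all entries of $v$ and of $Hv$ are nonzero this is written as the fixed-point equation $v=G_s(v)$, where $$G_s(v):=w+Y_{LL}^{-1}\left(\mathrm{diag}(\overline v)^{-1}\,\overline{s^Y}+H^{\mathsf T}\,\mathrm{diag}(H\overline v)^{-1}\,\overline{s^\Delta}\right).$$ Quantities. For $s\in\mathbb{C}^{6N}$: $$\xi^Y(s):=\|W^{-1}Y_{LL}^{-1}W^{-1}\mathrm{diag}(s^Y)\|_\infty,\qquad \xi^\Delta(s):=\|W^{-1}Y_{LL}^{-1}H^{\mathsf T}\mathrm{diag}(L|w|)^{-1}\mathrm{diag}(s^\Delta)\|_\infty,\qquad \xi(s):=\xi^Y(s)+\xi^\Delta(s).$$ For $v\in\mathbb{C}^{3N}$: $$\alpha(v):=\min_j\frac{|(v)_j|}{|(w)_j|},\qquad \beta(v):=\min_j\frac{|(Hv)_j|}{(L|w|)_j},\qquad \gamma(v):=\min\{\alpha(v),\beta(v)\},$$ with $j$ ranging over $1,\dots,3N$. Non-singularity. The load-flow equations define an explicit map $(v,i^\Delta)\mapsto(s^Y,s^\Delta)$ given by $$s^Y=\mathrm{diag}(v)\,\overline{(Y_{L0}v_0+Y_{LL}v)}-\mathrm{diag}(H^{\mathsf T}\overline{i^\Delta})\,v,\qquad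 s^\Delta=\mathrm{diag}(Hv)\,\overline{i^\Delta}.$$ Writing $x=(\Re s^Y,\Im s^Y,\Re s^\Delta,\Im s^\Delta)\in\mathbb{R}^{12N}$ and $y=(\Re v,\Im v,\Re i^\Delta,\Im i^\Delta)\in\mathbb{R}^{12N}$, this is a map $x=h(y)$, $h:\mathbb{R}^{12N}\to\mathbb{R}^{12N}$, with real Jacobian matrix $J(y)=(\partial h_i/\partial y_j)_{i,j=1}^{12N}$. A state $y$ (equivalently $(v,i^\Delta)$) is non-singular if $J(y)$ is invertible. A pair (operating point) $(v,s)$, where $v$ solves the load-flow equations with power injection $s$ and $Hv$ has no zero entries, is non-singular if the state $(v,i^\Delta)$ with $i^\Delta:=\mathrm{diag}(H\overline v)^{-1}\overline{s^\Delta}$ is non-singular. *)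

(* Defs.v *)
From HB Require Import structures.
From mathcomp Require Import all_boot all_order all_algebra.
From mathcomp Require Import complex.
From mathcomp Require Import all_classical all_reals all_analysis.

Set Implicit Arguments.
Unset Strict Implicit.
Unset Printing Implicit Defensive.

Import Order.TTheory GRing.Theory Num.Theory numFieldNormedType.Exports.

Local Open Scope classical_set_scope.
Local Open Scope ring_scope.

Definition diagc (K : pzRingType) n (x : 'cV[K]_n) : 'M[K]_n := diag_mx x^T.

Definition conjv (R : realType) n (x : 'cV[R[i]]_n) : 'cV[R[i]]_n :=
  map_mx conjc x.

(* Real-valued modulus: the norm [`|z|] of [z : R[i]] itself lives in [R[i]]. *)
Definition cmod (R : realType) (z : R[i]) : R := Normc.normc z.

Definition absv (R : realType) n (x : 'cV[R[i]]_n) : 'cV[R]_n := map_mx (@cmod R) x.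

Definition toC (R : realType) m n (A : 'M[R]_(m, n)) : 'M[R[i]]_(m, n) :=
  map_mx (real_complex R) A.

Definition norm_infty (R : realType) m n (A : 'M[R[i]]_(m, n)) : R :=
  \big[Num.max/0]_(i < m) \sum_(j < n) cmod (A i j).

(* [\big[Num.min/x0]] needs a seed: it is the first value of [f], so that the
   result is the minimum of [f] whenever [0 < n] (and 0 when [n = 0]). *)
Definition minI (R : realType) n (f : 'I_n -> R) : R :=
  \big[Num.min/head 0 (codom f)]_(j < n) f j.

(* Convergence in C^n for the topology of the library, which is attached to
   abstract number fields: hence the detour through [cfield]. *)
Definition cfield (R : realType) : numFieldType := R[i].

Definition cvgv (R : realType) n (u : nat -> 'cV[R[i]]_n) (l : 'cV[R[i]]_n) : Prop :=
  (u : nat -> 'cV[cfield R]_n) @ \oo --> (l : 'cV[cfield R]_n).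

Definition Gamma (R : realType) : 'M[R]_3 :=
  \matrix_(a < 3, b < 3)
    nth 0 (nth [::] [:: [::  1; -1;  0];
                        [::  0;  1; -1];
                        [:: -1;  0;  1]] a) b.

(* Block-diagonal, with blocks [Gamma]: [i %/ 3] is the block (the bus) and
   [i %% 3] the position in the block (the phase). *)
Definition Hmx (R : realType) (N : nat) : 'M[R]_(3 * N) :=
  \matrix_(i < 3 * N, j < 3 * N)
    if (i %/ 3 == j %/ 3)%N then Gamma R (inord (i %% 3)) (inord (j %% 3)) else 0.

Definition Lmx (R : realType) (N : nat) : 'M[R]_(3 * N) := map_mx Num.norm (Hmx R N).

Definition HC (R : realType) (N : nat) : 'M[R[i]]_(3 * N) := toC (Hmx R N).

(* The slack bus comes first. *)
Record network (R : realType) (N : nat) := Network {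
  admittance : 'M[R[i]]_(3 + 3 * N) ;
  slack : 'cV[R[i]]_3
}.

Definition YL0 (R : realType) N (net : network R N) : 'M[R[i]]_(3 * N, 3) :=
  dlsubmx (admittance net).

Definition YLL (R : realType) N (net : network R N) : 'M[R[i]]_(3 * N) :=
  drsubmx (admittance net).

Definition zero_load (R : realType) N (net : network R N) : 'cV[R[i]]_(3 * N) :=
  - (invmx (YLL net) *m YL0 net *m slack net).

Definition sY (R : realType) n (s : 'cV[R[i]]_(n + n)) : 'cV[R[i]]_n := usubmx s.
Definition sD (R : realType) n (s : 'cV[R[i]]_(n + n)) : 'cV[R[i]]_n := dsubmx s.

Definition load_flow (R : realType) N (net : network R N)
    (s : 'cV[R[i]]_(3 * N + 3 * N)) (v : 'cV[R[i]]_(3 * N)) : Prop :=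
  exists i iD : 'cV[R[i]]_(3 * N),
    [/\ diagc ((HC R N)^T *m conjv iD) *m v + sY s = diagc v *m conjv i,
        sD s = diagc (HC R N *m v) *m conjv iD
      & i = YL0 net *m slack net + YLL net *m v].

(* [invmx] is the identity on non-invertible matrices, so this is only
   meaningful when [v] and [H v] have no zero entry ([regular v] below). *)
Definition Gmap (R : realType) N (net : network R N)
    (s : 'cV[R[i]]_(3 * N + 3 * N)) (v : 'cV[R[i]]_(3 * N)) : 'cV[R[i]]_(3 * N) :=
  zero_load net + invmx (YLL net) *m
    (invmx (diagc (conjv v)) *m conjv (sY s)
     + (HC R N)^T *m (invmx (diagc (HC R N *m conjv v)) *m conjv (sD s))).

Definition regular (R : realType) N (v : 'cV[R[i]]_(3 * N)) : Prop :=
  (forall j, v j 0 != 0) /\ (forall j, (HC R N *m v) j 0 != 0).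

Definition xiY (R : realType) N (net : network R N)
    (s : 'cV[R[i]]_(3 * N + 3 * N)) : R :=
  let W := diagc (zero_load net) in
  norm_infty (invmx W *m invmx (YLL net) *m invmx W *m diagc (sY s)).

Definition xiD (R : realType) N (net : network R N)
    (s : 'cV[R[i]]_(3 * N + 3 * N)) : R :=
  let w := zero_load net in
  norm_infty (invmx (diagc w) *m invmx (YLL net) *m (HC R N)^T
              *m invmx (diagc (toC (Lmx R N *m absv w))) *m diagc (sD s)).

Definition xi (R : realType) N (net : network R N)
    (s : 'cV[R[i]]_(3 * N + 3 * N)) : R := xiY net s + xiD net s.

Definition alpha (R : realType) N (net : network R N) (v : 'cV[R[i]]_(3 * N)) : R :=
  minI (fun j => cmod (v j 0) / cmod (zero_load net j 0)).

Definition beta (R : realType) N (net : network R N) (v : 'cV[R[i]]_(3 * N)) : R :=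
  minI (fun j => cmod ((HC R N *m v) j 0) / (Lmx R N *m absv (zero_load net)) j 0).

Definition gamma (R : realType) N (net : network R N) (v : 'cV[R[i]]_(3 * N)) : R :=
  Num.min (alpha net v) (beta net v).

Definition disc (R : realType) N (net : network R N) (vhat : 'cV[R[i]]_(3 * N))
    (rho : R) : set 'cV[R[i]]_(3 * N) :=
  [set v | forall j, cmod (v j 0 - vhat j 0) <= rho * cmod (zero_load net j 0)].

(* The real vector (Re a, Im a, Re b, Im b), and its two complex halves. *)
Definition realify (R : realType) n (a b : 'cV[R[i]]_n) : 'rV[R]_((n + n) + (n + n)) :=
  row_mx (row_mx (map_mx (@complex.Re R) a)^T (map_mx (@complex.Im R) a)^T)
         (row_mx (map_mx (@complex.Re R) b)^T (map_mx (@complex.Im R) b)^T).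

Definition complexify (R : realType) n (x : 'rV[R]_(n + n)) : 'cV[R[i]]_n :=
  \col_j (lsubmx x 0 j +i* rsubmx x 0 j)%C.

Definition inj_Y (R : realType) N (net : network R N)
    (v iD : 'cV[R[i]]_(3 * N)) : 'cV[R[i]]_(3 * N) :=
  diagc v *m conjv (YL0 net *m slack net + YLL net *m v)
  - diagc ((HC R N)^T *m conjv iD) *m v.

Definition inj_D (R : realType) N (v iD : 'cV[R[i]]_(3 * N)) : 'cV[R[i]]_(3 * N) :=
  diagc (HC R N *m v) *m conjv iD.

Definition hmap (R : realType) N (net : network R N)
    (y : 'rV[R]_((3 * N + 3 * N) + (3 * N + 3 * N))) :
    'rV[R]_((3 * N + 3 * N) + (3 * N + 3 * N)) :=
  let v := complexify (lsubmx y) in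
  let iD := complexify (rsubmx y) in
  realify (inj_Y net v iD) (inj_D v iD).

Definition Jmx (R : realType) N (net : network R N)
    (y : 'rV[R]_((3 * N + 3 * N) + (3 * N + 3 * N))) :
    'M[R]_((3 * N + 3 * N) + (3 * N + 3 * N)) :=
  \matrix_(i, j) 'D_(delta_mx 0 j) (fun z => hmap net z 0 i) y.

Definition nonsingular_state (R : realType) N (net : network R N)
    (v iD : 'cV[R[i]]_(3 * N)) : Prop :=
  Jmx net (realify v iD) \in unitmx.

Definition nonsingular (R : realType) N (net : network R N)
    (v : 'cV[R[i]]_(3 * N)) (s : 'cV[R[i]]_(3 * N + 3 * N)) : Prop :=
  [/\ load_flow net s v,
      forall j, (HC R N *m v) j 0 != 0
    & nonsingular_state net v
        (invmx (diagc (HC R N *m conjv v)) *m conjv (sD s))].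

(* Main.v *)
Require Import Defs.
From HB Require Import structures.
From mathcomp Require Import all_boot all_order all_algebra.
From mathcomp Require Import complex ring lra.
From mathcomp Require Import all_classical all_reals all_analysis.

Set Implicit Arguments.
Unset Strict Implicit.
Unset Printing Implicit Defensive.

Import Order.TTheory GRing.Theory Num.Theory numFieldNormedType.Exports.

Local Open Scope classical_set_scope.
Local Open Scope ring_scope.

(* In the sup norm weighted by |w|, changing the load currents by at most
   d |s^Y| / |w| (star) and d |s^Delta| / L|w| (delta) changes the voltage
   Y_LL^{-1} (...) by at most d * xi(s). On the disc of radius
   r < g = gamma(vhat), voltages keep |v| >= (g - r)|w| and |Hv| >= (g - r) L|w|,
   so G_s is Lipschitz there with constant xi(s)/(g - r)^2; comparing with
   vhat = G_shat(vhat), it maps the disc to itself as soon as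
   r^2 - 2 rho2 r + xi(s - shat) <= 0, i.e. for rho1 <= r <= rho2. Moreover
   (g - rho2)^2 = xi(shat) + rho2^2 > xi(s), hence contraction.
   The Jacobian is injective for the same reason: eliminating the delta
   currents, a kernel vector dv is a fixed point of the differential of G_s at v,
   whose norm is at most xi(s)/gamma(v)^2 < 1. *)

(** * Real-valued modulus of complex numbers *)

Section Modulus.
Variable R : realType.
Implicit Types x y z : R[i].

Lemma cmod_ge0 z : 0 <= cmod z.
Proof. by case: z => a b; exact: sqrtr_ge0. Qed.

Lemma cmod0 : cmod (0 : R[i]) = 0. Proof. exact: Normc.normc0. Qed.

Lemma cmod_eq0 z : (cmod z == 0) = (z == 0).
Proof.
by apply/eqP/eqP => [/Normc.eq0_normc //|->]; exact: cmod0.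
Qed.

Lemma cmod_gt0 z : (0 < cmod z) = (z != 0).
Proof. by rewrite lt_neqAle cmod_ge0 andbT eq_sym cmod_eq0. Qed.

Lemma cmodM x y : cmod (x * y) = cmod x * cmod y.
Proof. exact: Normc.normcM. Qed.

Lemma cmodV z : cmod z^-1 = (cmod z)^-1.
Proof. exact: Normc.normcV. Qed.

Lemma cmodN z : cmod (- z) = cmod z.
Proof. by case: z => a b; rewrite /cmod /= !sqrrN. Qed.

Lemma cmodD x y : cmod (x + y) <= cmod x + cmod y.
Proof. exact: le_normcD. Qed.

Lemma cmodB x y : cmod (x - y) = cmod (y - x).
Proof. by rewrite -cmodN opprB. Qed.

Lemma cmod_dist z x y : cmod (x - y) <= cmod (x - z) + cmod (z - y).
Proof. by rewrite -[x - y](subrKA z); exact: cmodD. Qed.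

Lemma cmod_le_dist x y : cmod y <= cmod x + cmod (x - y).
Proof. by rewrite -[in leLHS](subKr x y) (le_trans (cmodD _ _)) // cmodN. Qed.

Lemma cmod_conj z : cmod (conjc z) = cmod z.
Proof. by case: z => a b; rewrite /cmod /= sqrrN. Qed.

Lemma conjc_div x y : conjc (x / y) = conjc x / conjc y.
Proof. by rewrite rmorphM; congr (_ * _); exact: conjc_inv. Qed.

Lemma cmod_real (r : R) : cmod (real_complex R r) = `|r|.
Proof. by rewrite /cmod /= expr0n addr0 sqrtr_sqr. Qed.

Lemma cmod_sum (I : finType) (F : I -> R[i]) :
  cmod (\sum_i F i) <= \sum_i cmod (F i).
Proof.
elim/big_ind2 : _ => // [|x a y b xa yb]; first by rewrite cmod0.
by rewrite (le_trans (cmodD _ _)) // lerD.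
Qed.

Lemma normC_cmod z : `|z| = real_complex R (cmod z).
Proof. by case: z. Qed.

Lemma Re_le_cmod z : `|complex.Re z| <= cmod z.
Proof.
case: z => a b; rewrite /cmod /= -sqrtr_sqr ler_wsqrtr //.
by rewrite lerDl sqr_ge0.
Qed.

Lemma Im_le_cmod z : `|complex.Im z| <= cmod z.
Proof.
case: z => a b; rewrite /cmod /= -sqrtr_sqr ler_wsqrtr //.
by rewrite lerDr sqr_ge0.
Qed.

Lemma cmod_le_ReIm z : cmod z <= `|complex.Re z| + `|complex.Im z|.
Proof.
rewrite {1}[z]complexE (le_trans (cmodD _ _)) // cmodM !cmod_real.
by rewrite /cmod /= expr0n expr1n add0r sqrtr1 mul1r.
Qed.

End Modulus.

(** * Sequences controlled by a geometric rate *)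

Section GeometricSequences.
Variable R : realType.
Implicit Types q C : R.

(** Let [k] tend to infinity. Applied to a modulus, this turns a family of geometric estimates into
    an equality; uniqueness, the fixed-point identity and the triviality of the kernel all end this
    way. *)
Lemma geometric_bound_le0 q C (x : R) : 0 <= q -> q < 1 ->
  (forall k, x <= C * q ^+ k) -> x <= 0.
Proof.
move=> q0 q1 xC.
have cv : (fun k => C * q ^+ k) @ \oo --> (0 : R).
  by apply: cvg_geometric; rewrite ger0_norm.
by rewrite -(cvg_lim _ cv)//; apply: limr_ge; [apply: cvgP cv|apply: nearW].
Qed.

(* The sequences [u k -+ C q^k / (1 - q)] are monotone: [l] is the common
   bound that separates them. *)
Lemma geometric_increments_cvg q C (u : nat -> R) : 0 <= q -> q < 1 ->
  (forall k, `|u k.+1 - u k| <= C * q ^+ k) ->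
  exists l, forall k, `|u k - l| <= C / (1 - q) * q ^+ k.
Proof.
move=> q0 q1 uC.
pose c := C / (1 - q).
(* Telescoping form of the increment bound: the corrections [c * q ^+ k] absorb exactly one
   increment, which makes [a] nondecreasing and [b] nonincreasing. *)
have cq k : C * q ^+ k = c * q ^+ k - c * q ^+ k.+1.
  rewrite exprS /c; field; lra.
have c0 : 0 <= c.
  have := le_trans (normr_ge0 _) (uC 0%N); rewrite expr0 mulr1 => C0.
  by rewrite divr_ge0 // subr_ge0 ltW.
pose a k := u k - c * q ^+ k; pose b k := u k + c * q ^+ k.
have aS k : a k <= a k.+1.
  by have := uC k; rewrite cq ler_norml /a => /andP[]; lra.
have bS k : b k.+1 <= b k.
  by have := uC k; rewrite cq ler_norml /b => /andP[]; lra.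
have aD m k : a k <= a (k + m)%N.
  by elim: m => [|m /le_trans->//]; rewrite ?addn0 // addnS.
have bD m k : b (k + m)%N <= b k.
  elim: m => [|m IH]; first by rewrite addn0.
  by rewrite addnS (le_trans (bS _)).
have ab k : a k <= b k.
  have := mulr_ge0 c0 (exprn_ge0 k q0); rewrite /a /b; lra.
have abm k m : a k <= b m.
  by rewrite (le_trans (aD m k)) // (le_trans (ab _)) // addnC bD.
pose A : set R := range a.
have Aub m : ubound A (b m) by move=> _ [k _ <-].
have Asup : has_sup A by split; [exists (a 0%N), 0%N|exists (b 0%N)].
exists (sup A) => k; rewrite -/c.
have ak : a k <= sup A by apply: ub_le_sup; [case: Asup|exists k].
have bk : sup A <= b k by apply: ge_sup; [case: Asup|exact: Aub].
rewrite ler_norml; move: ak bk; rewrite /a /b; lra.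
Qed.

(** Real and imaginary parts converge separately; the factor 2 comes from |z| <= |Re z| + |Im z|. *)
Lemma cgeometric_increments_cvg q C (u : nat -> R[i]) : 0 <= q -> q < 1 ->
  (forall k, cmod (u k.+1 - u k) <= C * q ^+ k) ->
  exists l, forall k, cmod (u k - l) <= (C / (1 - q)) *+ 2 * q ^+ k.
Proof.
move=> q0 q1 uC.
have [] := @geometric_increments_cvg q C (fun k => complex.Re (u k)) q0 q1.
  move=> k; rewrite (le_trans _ (uC k)) // -raddfB; exact: Re_le_cmod.
move=> x ux.
have [] := @geometric_increments_cvg q C (fun k => complex.Im (u k)) q0 q1.
  move=> k; rewrite (le_trans _ (uC k)) // -raddfB; exact: Im_le_cmod.
move=> y uy; exists (x +i* y)%C => k.
rewrite (le_trans (cmod_le_ReIm _)) // mulr2n mulrDl lerD // !raddfB //=.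
Qed.

Lemma geometric_cvgv n q (C : 'I_n -> R) (u : nat -> 'cV[R[i]]_n)
    (l : 'cV[R[i]]_n) :
  0 <= q -> q < 1 ->
  (forall k j, cmod (u k j 0 - l j 0) <= C j * q ^+ k) -> cvgv u l.
Proof.
move=> q0 q1 uC; rewrite /cvgv; apply/cvg_ballP => e e0.
(* The radius [e] of the ball is a complex number; being positive in [R[i]], it has zero imaginary
   part. *)
have [r r0 re] : exists2 r : R, 0 < r & real_complex R r = e.
  move: e0; rewrite ltcE => /andP[/eqP ei er]; exists (complex.Re e) => //.
  by case: {er} e ei => a b /= ->.
have small j : \forall k \near \oo, C j * q ^+ k < r.
  have /cvgrPdist_lt/(_ r r0) : (fun k => C j * q ^+ k) @ \oo --> (0 : R).
    by apply: cvg_geometric; rewrite ger0_norm.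
  by apply: filterS => k; rewrite sub0r normrN; exact: le_lt_trans (ler_norm _).
have : \forall k \near \oo, forall j, C j * q ^+ k < r.
  exact: filter_forall.
apply: filterS => k kr.
split=> // j i; rewrite ord1 /ball /= -re.
rewrite (_ : `|_| = real_complex R (cmod (l j 0 - u k j 0))).
  by rewrite ltcR cmodB (le_lt_trans (uC k j)).
exact: normC_cmod.
Qed.

End GeometricSequences.

(** * Contraction principle in a weighted sup norm *)

Section WeightedBanach.
Variables (R : realType) (n : nat) (wt : 'I_n -> R) (c : 'cV[R[i]]_n).
Variables (rho q : R) (F : 'cV[R[i]]_n -> 'cV[R[i]]_n).
Let D : set 'cV[R[i]]_n := [set v | forall j, cmod (v j 0 - c j 0) <= rho * wt j].
Hypotheses (rho0 : 0 <= rho) (wt0 : forall j, 0 <= wt j) (q0 : 0 <= q) (q1 : q < 1).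
Hypothesis F_stable : forall v, D v -> D (F v).
Hypothesis F_lip : forall u v d, D u -> D v -> 0 <= d ->
  (forall j, cmod (u j 0 - v j 0) <= d * wt j) ->
  forall j, cmod (F u j 0 - F v j 0) <= q * d * wt j.

(** Banach's theorem for the norm max |v_j| / wt_j, with every estimate kept multiplied by the
    weights so that nothing is divided by them. The limit is built from the orbit of the centre
    [c]. *)
Lemma weighted_banach : exists v, [/\ D v, F v = v &
  forall u, D u -> forall k j,
    cmod (iter k F u j 0 - v j 0) <= 2 * rho * wt j * q ^+ k].
Proof.
have Dc : D c by move=> j; rewrite subrr cmod0 mulr_ge0.
have iterD u k : D u -> D (iter k F u).
  by move=> Du; elim: k => //= k; exact: F_stable.
(* Two orbits start at most a diameter [2 * rho] apart and approach at rate [q]. Taking [F c] and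
   [c] bounds the increments of one orbit; taking a fixed point for [v] gives the final rate. *)
have iter_dist u v k j : D u -> D v ->
    cmod (iter k F u j 0 - iter k F v j 0) <= 2 * rho * wt j * q ^+ k.
  move=> Du Dv; rewrite mulrAC; elim: k j => [|k IH] j.
    rewrite expr0 mulr1 (le_trans (cmod_dist (c j 0) _ _)) //.
    by rewrite (cmodB (c j 0)) -mulrA mulr_natl mulr2n lerD.
  rewrite exprSr mulrA [_ * q]mulrC; apply: F_lip; try exact: iterD.
    by rewrite !mulr_ge0 // exprn_ge0.
  exact: IH.
pose x k := iter k F c.
have /fin_all_exists[l xl] j : exists l, forall k,
    cmod (x k j 0 - l) <= (2 * rho * wt j / (1 - q)) *+ 2 * q ^+ k.
  apply: cgeometric_increments_cvg => // k.
  by rewrite /x iterSr; apply: iter_dist => //; exact: F_stable.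
pose v : 'cV[R[i]]_n := \col_j l j.
pose K : R := (2 * rho / (1 - q)) *+ 2.
have K0 : 0 <= K by rewrite mulrn_wge0 // divr_ge0 ?mulr_ge0 // subr_ge0 ltW.
have xv k j : cmod (x k j 0 - v j 0) <= K * q ^+ k * wt j.
  rewrite mxE (le_trans (xl j k)) // le_eqVlt; apply/orP; left; apply/eqP.
  by rewrite /K !mulr2n; ring.
have Dv : D v.
  move=> j; rewrite -subr_le0.
  apply: (@geometric_bound_le0 _ q (K * wt j)) => // k.
  rewrite lerBlDr (le_trans (cmod_dist (x k j 0) _ _)) // lerD //.
    by rewrite cmodB (le_trans (xv _ _)) // mulrAC.
  exact: iterD.
have Fv : F v = v.
  (* Both [F v] and [v] lie within [K * q ^+ k.+1 * wt j] of the iterate [x k.+1]. *)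
  apply/colP => j; apply/eqP; rewrite -subr_eq0 -cmod_eq0 eq_le cmod_ge0 andbT.
  apply: (@geometric_bound_le0 _ q (2 * q * K * wt j)) => // k.
  rewrite (le_trans (cmod_dist (x k.+1 j 0) _ _)) //.
  have := xv k.+1 j; rewrite exprS => h2.
  have h1 : cmod (F v j 0 - x k.+1 j 0) <= q * (K * q ^+ k) * wt j.
    apply: F_lip => //; first exact: iterD.
      by rewrite mulr_ge0 ?exprn_ge0.
    by move=> i; rewrite cmodB.
  rewrite (le_trans (lerD h1 h2)) // le_eqVlt; apply/orP; left; apply/eqP; ring.
exists v; split=> // u Du k j.
by have := @iter_dist u v k j Du Dv; rewrite [iter k F v]iter_fix.
Qed.

End WeightedBanach.

(** * Row-sum norm, finite minima and diagonal matrices *)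

Section Bounds.
Variable R : realType.

Lemma row_le_norm_infty m n (A : 'M[R[i]]_(m, n)) i :
  \sum_j cmod (A i j) <= norm_infty A.
Proof. exact: le_bigmax. Qed.

Lemma norm_infty_ge0 m n (A : 'M[R[i]]_(m, n)) : 0 <= norm_infty A.
Proof. exact: bigmax_ge_id. Qed.

Lemma norm_inftyD m n (A B : 'M[R[i]]_(m, n)) :
  norm_infty (A + B) <= norm_infty A + norm_infty B.
Proof.
apply: bigmax_le => [|i _]; first by rewrite addr_ge0 // norm_infty_ge0.
rewrite (le_trans _ (lerD (row_le_norm_infty A i) (row_le_norm_infty B i))) //.
by rewrite -big_split /=; apply: ler_sum => j _; rewrite mxE cmodD.
Qed.

Lemma minI_le n (f : 'I_n -> R) j : minI f <= f j.
Proof. exact: bigmin_le. Qed.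

(** For [0 < n] the seed of the minimum is itself a value of [f]; for [n = 0] it would be the
    default 0. *)
Lemma le_minI n (f : 'I_n -> R) m : (0 < n)%N -> (forall j, m <= f j) -> m <= minI f.
Proof.
move=> n0 mf; apply: le_bigmin => [|j _]; last exact: mf.
case E : (codom f) => [|x s] /=.
  by have := size_codom f; rewrite E card_ord; case: n {f mf E} n0.
have /codomP[j ->] : x \in codom f by rewrite E mem_head.
exact: mf.
Qed.

Lemma colDE n (x y : 'cV[R[i]]_n) j : (x + y) j 0 = x j 0 + y j 0.
Proof. by rewrite !mxE. Qed.

Lemma colBE n (x y : 'cV[R[i]]_n) j : (x - y) j 0 = x j 0 - y j 0.
Proof. by rewrite !mxE. Qed.

Lemma diagcD n (x y : 'cV[R[i]]_n) : diagc (x + y) = diagc x + diagc y.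
Proof. by rewrite /diagc !linearD. Qed.

Lemma diagcE n (x : 'cV[R[i]]_n) i j : diagc x i j = x i 0 *+ (i == j).
Proof. by rewrite !mxE; case: eqP => [->|]. Qed.

Lemma mul_diagc_mx n p (x : 'cV[R[i]]_n) (A : 'M[R[i]]_(n, p)) i j :
  (diagc x *m A) i j = x i 0 * A i j.
Proof. by rewrite mul_diag_mx !mxE. Qed.

Lemma mul_mx_diagc n p (A : 'M[R[i]]_(p, n)) (x : 'cV[R[i]]_n) i j :
  (A *m diagc x) i j = A i j * x j 0.
Proof. by rewrite mul_mx_diag !mxE. Qed.

Lemma invmx_diagc n (x : 'cV[R[i]]_n) :
  (forall j, x j 0 != 0) -> invmx (diagc x) = diagc (map_mx (fun z => z^-1) x).
Proof.
move=> x0.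
have xV : diagc x *m diagc (map_mx (fun z => z^-1) x) = 1%:M.
  by apply/matrixP => i j; rewrite mul_diagc_mx diagcE !mxE mulrnAr divff.
have [xu _] := mulmx1_unit xV.
by rewrite -[LHS]mulmx1 -xV mulKmx.
Qed.

Lemma invmx_diagc_mul n (x y : 'cV[R[i]]_n) j :
  (forall j, x j 0 != 0) -> (invmx (diagc x) *m y) j 0 = (x j 0)^-1 * y j 0.
Proof. by move=> x0; rewrite invmx_diagc // mul_diagc_mx mxE. Qed.

End Bounds.

(** * Estimates for [Gmap], and its fixed points as load-flow solutions *)

Section Network.
Variables (R : realType) (N : nat) (net : network R N).
Hypothesis hYLL : YLL net \in unitmx.
Hypothesis hw : forall j, zero_load net j 0 != 0.

Local Notation vec := 'cV[R[i]]_(3 * N).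
Local Notation pow := 'cV[R[i]]_(3 * N + 3 * N).
Implicit Types (u v : vec) (s : pow) (m d : R).
Let w := zero_load net.
Let Lw : 'cV[R]_(3 * N) := Lmx R N *m absv w.
Let H := HC R N.
Let Yi := invmx (YLL net).

Lemma HC_conj (v : vec) : H *m conjv v = conjv (H *m v).
Proof.
apply/colP => j; rewrite !mxE rmorph_sum; apply: eq_bigr => k _.
by rewrite rmorphM !mxE /= oppr0.
Qed.

Lemma HCtr_conj (v : vec) : H^T *m conjv v = conjv (H^T *m v).
Proof.
apply/colP => j; rewrite !mxE rmorph_sum; apply: eq_bigr => k _.
by rewrite rmorphM !mxE /= oppr0.
Qed.

Lemma LwE j : Lw j 0 = \sum_k `|Hmx R N j k| * cmod (w k 0).
Proof. by rewrite mxE; apply: eq_bigr => k _; rewrite mxE [absv w k 0]mxE. Qed.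

Lemma cmod_HC (v : vec) (d : R) : (forall j, cmod (v j 0) <= d * cmod (w j 0)) ->
  forall j, cmod ((H *m v) j 0) <= d * Lw j 0.
Proof.
move=> vd j; rewrite LwE mxE (le_trans (cmod_sum _)) // mulr_sumr ler_sum // => k _.
by rewrite cmodM [H j k]mxE cmod_real mulrCA ler_wpM2l.
Qed.

Lemma HC_dist (u v : vec) (d : R) :
  (forall j, cmod (u j 0 - v j 0) <= d * cmod (w j 0)) ->
  forall j, cmod ((H *m u) j 0 - (H *m v) j 0) <= d * Lw j 0.
Proof.
move=> uv j; have -> : (H *m u) j 0 - (H *m v) j 0 = (H *m (u - v)) j 0.
  by rewrite mulmxBr colBE.
by apply: cmod_HC => k; rewrite colBE.
Qed.

(** The diagonal of [Gamma] consists of ones, so the sum contains the positive term |w_j|. *)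
Lemma Lw_gt0 j : 0 < Lw j 0.
Proof.
rewrite LwE (bigD1 j) //= ltr_pwDl //; last first.
  by apply: sumr_ge0 => k _; rewrite mulr_ge0 // cmod_ge0.
rewrite mulr_gt0 ?cmod_gt0 // mxE eqxx mxE inordK ?ltn_mod //.
by case: (j %% 3)%N (ltn_pmod j (isT : 0 < 3)%N) => [|[|[|]]] //= _;
  rewrite normr1.
Qed.

(** Division-free form of m <= gamma(v): [gamma_margin] and [le_gamma] are the two directions. *)
Definition margin (m : R) (v : vec) : Prop :=
  (forall j, m * cmod (w j 0) <= cmod (v j 0)) /\
  (forall j, m * Lw j 0 <= cmod ((H *m v) j 0)).

Lemma gamma_margin v : margin (gamma net v) v.
Proof.
split=> j; rewrite -ler_pdivlMr ?cmod_gt0 ?Lw_gt0 // ge_min.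
  by rewrite (minI_le (fun j => cmod (v j 0) / cmod (zero_load net j 0))).
by rewrite (minI_le (fun j => cmod ((HC R N *m v) j 0) /
  (Lmx R N *m absv (zero_load net)) j 0)) orbT.
Qed.

Lemma le_gamma m v : (0 < N)%N -> margin m v -> m <= gamma net v.
Proof.
move=> N0 [mv mHv]; rewrite le_min; apply/andP; split; apply: le_minI;
  rewrite ?muln_gt0 // => j; rewrite ler_pdivlMr ?cmod_gt0 //; exact: Lw_gt0.
Qed.

(** Reverse triangle inequality: moving [v] by [d] in the weighted norm moves H v by at most d L|w|,
    so both ratios drop by at most [d]. *)
Lemma margin_dist m d u v : margin m v ->
  (forall j, cmod (u j 0 - v j 0) <= d * cmod (w j 0)) -> margin (m - d) u.
Proof.
move=> [mv mHv] uvd; split=> j.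
  rewrite mulrBl lerBlDr (le_trans (mv j)) //.
  by rewrite (le_trans (cmod_le_dist (u j 0) _)) // lerD.
rewrite mulrBl lerBlDr (le_trans (mHv j)) //.
rewrite (le_trans (cmod_le_dist ((H *m u) j 0) _)) // lerD //.
exact: HC_dist.
Qed.

Lemma margin_gt0 m v : 0 < m -> margin m v ->
  (forall j, 0 < cmod (v j 0)) /\ (forall j, 0 < cmod ((H *m v) j 0)).
Proof.
by move=> m0 [mv mHv]; split=> j; [apply: lt_le_trans (mv j)|apply: lt_le_trans (mHv j)];
  rewrite mulr_gt0 ?cmod_gt0 //; exact: Lw_gt0.
Qed.

Lemma margin_regular m v : 0 < m -> margin m v -> regular v.
Proof.
by move=> m0 /(margin_gt0 m0)[v0 Hv0]; split=> j; rewrite -cmod_gt0.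
Qed.

Lemma xiYE s : xiY net s =
  norm_infty (\matrix_(j, k) ((w j 0)^-1 * Yi j k * ((w k 0)^-1 * sY s k 0))).
Proof.
rewrite /xiY; congr norm_infty; apply/matrixP => j k.
by rewrite mul_mx_diagc invmx_diagc // mul_mx_diagc mul_diagc_mx !mxE !mulrA.
Qed.

Lemma xiDE s : xiD net s =
  norm_infty (\matrix_(j, k) ((w j 0)^-1 * (Yi *m H^T) j k *
    ((real_complex R (Lw k 0))^-1 * sD s k 0))).
Proof.
rewrite /xiD; congr norm_infty; apply/matrixP => j k.
rewrite mul_mx_diagc [invmx (diagc (toC _))]invmx_diagc => [|i]; last first.
  by rewrite mxE -cmod_gt0 cmod_real normr_gt0 gt_eqF // Lw_gt0.
by rewrite mul_mx_diagc invmx_diagc // -!mulmxA mul_diagc_mx ![in LHS]mxE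
  ![in RHS]mxE !mulrA.
Qed.

Lemma xi_ge0 s : 0 <= xi net s.
Proof. by rewrite addr_ge0 // norm_infty_ge0. Qed.

Lemma xi_triangle s s' : xi net (s + s') <= xi net s + xi net s'.
Proof.
by rewrite /xi addrACA lerD // /xiY /xiD /sY /sD linearD /= diagcD mulmxDr
  norm_inftyD.
Qed.

(** Since |a_k| <= d |p_k| / |q_k|, the j-th entry divided by |w_j| is at most [d] times a row sum
    of the scaled matrix. The scaling [q] is w for star loads and L|w| for delta loads. Only moduli
    occur, so the conjugates in the currents are harmless. *)
Lemma weighted_row_bound (A : 'M[R[i]]_(3 * N)) (p a : vec) (q : 'I_(3 * N) -> R[i]) d :
  0 <= d -> (forall k, q k != 0) ->
  (forall k, cmod (a k 0) * cmod (q k) <= d * cmod (p k 0)) ->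
  forall j, cmod ((A *m a) j 0) <= d *
   norm_infty (\matrix_(j, k) ((w j 0)^-1 * A j k * ((q k)^-1 * p k 0))) * cmod (w j 0).
Proof.
move=> d0 q0 ap j; rewrite mxE (le_trans (cmod_sum _)) //.
rewrite -ler_pdivrMr ?cmod_gt0 //.
apply: (@le_trans _ _
  (d * \sum_k cmod ((w j 0)^-1 * A j k * ((q k)^-1 * p k 0)))); last first.
  rewrite ler_wpM2l // (le_trans _ (row_le_norm_infty _ j)) //.
  by rewrite le_eqVlt; apply/orP; left; apply/eqP/eq_bigr => k _; rewrite [in RHS]mxE.
rewrite mulr_suml mulr_sumr; apply: ler_sum => k _.
have aq : cmod (a k 0) <= d * (cmod (p k 0) / cmod (q k)).
  by rewrite mulrA ler_pdivlMr ?cmod_gt0.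
have Aw : 0 <= cmod (A j k) / cmod (w j 0) by rewrite divr_ge0 ?cmod_ge0.
rewrite !cmodM !cmodV.
have -> : cmod (A j k) * cmod (a k 0) / cmod (w j 0) =
  cmod (A j k) / cmod (w j 0) * cmod (a k 0) by ring.
by rewrite (le_trans (ler_wpM2l Aw aq)) // le_eqVlt; apply/orP; left; apply/eqP; ring.
Qed.

(* [a] and [b] stand for any variation of the star and delta load currents
   that is of relative size [d] with respect to [s]. *)
Lemma xi_bound s d (a b : vec) : 0 <= d ->
  (forall k, cmod (a k 0) * cmod (w k 0) <= d * cmod (sY s k 0)) ->
  (forall k, cmod (b k 0) * Lw k 0 <= d * cmod (sD s k 0)) ->
  forall j, cmod ((Yi *m (a + H^T *m b)) j 0) <= d * xi net s * cmod (w j 0).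
Proof.
move=> d0 ha hb j; rewrite mulmxDr mxE (le_trans (cmodD _ _)) //.
rewrite mulrDr mulrDl lerD //.
  by rewrite xiYE; apply: (weighted_row_bound _ (q := fun k => w k 0)).
rewrite xiDE mulmxA.
apply: (weighted_row_bound _ (q := fun k => real_complex R (Lw k 0))) => // k.
  by rewrite -cmod_gt0 cmod_real normr_gt0 gt_eqF // Lw_gt0.
by rewrite cmod_real gtr0_norm ?Lw_gt0.
Qed.

Definition star_current s (v : vec) : vec := invmx (diagc (conjv v)) *m conjv (sY s).
(** Unfolds to the delta current that [nonsingular] prescribes, so the kernel computation below
    concerns that very state. *)
Definition delta_current s (v : vec) : vec :=
  invmx (diagc (H *m conjv v)) *m conjv (sD s).

Lemma star_currentE s v j : regular v ->
  star_current s v j 0 = conjc (sY s j 0 / v j 0).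
Proof.
move=> [v0 _]; rewrite /star_current invmx_diagc_mul => [|k].
  by rewrite conjc_div mulrC; congr (_ / _); rewrite mxE.
by rewrite mxE conjc_eq0.
Qed.

Lemma delta_currentE s v j : regular v ->
  delta_current s v j 0 = conjc (sD s j 0 / (H *m v) j 0).
Proof.
move=> [_ v0]; rewrite /delta_current HC_conj invmx_diagc_mul => [|k].
  by rewrite conjc_div mulrC; congr (_ / _); rewrite mxE.
by rewrite mxE conjc_eq0.
Qed.

Lemma GmapE s v :
  Gmap net s v = w + Yi *m (star_current s v + H^T *m delta_current s v).
Proof. by []. Qed.

Lemma Gmap_sub s s' u v : Gmap net s u - Gmap net s' v =
  Yi *m ((star_current s u - star_current s' v)
         + H^T *m (delta_current s u - delta_current s' v)).
Proof. by rewrite !GmapE opprD addrACA subrr add0r -mulmxBr opprD addrACA -mulmxBr. Qed.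

(** From p/x - p/y = p (y - x)/(x y), each current varies by a relative amount d/(m m'), and
    [xi_bound] applies. Two separate margins are kept because one of the points may be [vhat], whose
    margin is better than that of the disc. *)
Lemma Gmap_lip s u v m m' d : 0 < m -> 0 < m' -> margin m u -> margin m' v ->
  0 <= d -> (forall j, cmod (u j 0 - v j 0) <= d * cmod (w j 0)) ->
  forall j, cmod (Gmap net s u j 0 - Gmap net s v j 0) <=
    d / (m * m') * xi net s * cmod (w j 0).
Proof.
move=> m0 m'0 mu mv d0 uv j.
have ru := margin_regular m0 mu; have rv := margin_regular m'0 mv.
have Huv := HC_dist uv.
(* One scalar estimate for both load types: [z] is |w_k| for star currents and (L|w|)_k for delta
   currents. *)
have key (p x y : R[i]) (z : R) : x != 0 -> y != 0 -> 0 < z ->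
    m * z <= cmod x -> m' * z <= cmod y -> cmod (x - y) <= d * z ->
    cmod (conjc (p / x) - conjc (p / y)) * z <= d / (m * m') * cmod p.
  move=> x0 y0 z0 mx my xy.
  have -> : conjc (p / x) - conjc (p / y) = conjc (p * (y - x) / (x * y)).
    by rewrite -rmorphB; congr conjc; field; apply/andP.
  have mm0 : 0 < m * m' by rewrite mulr_gt0.
  have xy0 : 0 < cmod x * cmod y by rewrite mulr_gt0 ?cmod_gt0.
  have xyz : cmod (x - y) * z / (cmod x * cmod y) <= d / (m * m').
    rewrite ler_pdivrMr // mulrAC ler_pdivlMr //.
    rewrite (le_trans (ler_wpM2r (ltW mm0) (ler_wpM2r (ltW z0) xy))) //.
    have -> : d * z * z * (m * m') = d * (m * z * (m' * z)) by ring.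
    by rewrite ler_wpM2l // ler_pM // mulr_ge0 // ltW.
  rewrite cmod_conj !cmodM cmodV cmodM (cmodB y) [leRHS]mulrC.
  have -> : cmod p * cmod (x - y) / (cmod x * cmod y) * z =
    cmod p * (cmod (x - y) * z / (cmod x * cmod y)) by ring.
  by rewrite ler_wpM2l ?cmod_ge0.
rewrite -colBE Gmap_sub; apply: xi_bound => [|k|k].
- by rewrite divr_ge0 // mulr_ge0 // ltW.
- rewrite colBE !star_currentE //.
  by apply: key => //; [case: ru|case: rv|rewrite cmod_gt0|case: mu|case: mv].
- rewrite colBE !delta_currentE //.
  by apply: key => //; [case: ru|case: rv|exact: Lw_gt0|case: mu|case: mv].
Qed.

(** At a fixed voltage the currents are additive in [s] up to conjugation, so only [s - s'] enters,
    divided by a voltage of relative size at least [m]. *)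
Lemma Gmap_perturb s s' u m : 0 < m -> margin m u ->
  forall j, cmod (Gmap net s u j 0 - Gmap net s' u j 0) <=
    m^-1 * xi net (s - s') * cmod (w j 0).
Proof.
move=> m0 mu j; have ru := margin_regular m0 mu.
have key (p p' x : R[i]) (z : R) : x != 0 -> 0 < z -> m * z <= cmod x ->
    cmod (conjc (p / x) - conjc (p' / x)) * z <= m^-1 * cmod (p - p').
  move=> x0 z0 mx; rewrite -rmorphB -mulrBl cmod_conj cmodM cmodV.
  rewrite -mulrA mulrC ler_wpM2r ?cmod_ge0 //.
  by rewrite mulrC ler_pdivrMr ?cmod_gt0 // mulrC ler_pdivlMr // mulrC.
rewrite -colBE Gmap_sub; apply: xi_bound => [|k|k].
- by rewrite invr_ge0 ltW.
- rewrite colBE !star_currentE // /sY raddfB /= colBE.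
  by apply: key => //; [case: ru|rewrite cmod_gt0|case: mu].
- rewrite colBE !delta_currentE // /sD raddfB /= colBE.
  by apply: key => //; [case: ru|exact: Lw_gt0|case: mu].
Qed.

(** By definition of w, Y_LL w = - Y_L0 v_0. *)
Lemma zero_load_current v :
  YL0 net *m slack net + YLL net *m v = YLL net *m (v - w).
Proof.
by rewrite mulmxBr /w /zero_load mulmxN opprK -mulmxA mulKVmx // addrC.
Qed.

(** With no zero in v and H v, the delta equation determines [iD], then the star equation determines
    [i]; the network equation becomes v = w + Y_LL^{-1} i. *)
Lemma load_flow_Gmap s v : regular v -> load_flow net s v <-> Gmap net s v = v.
Proof.
move=> rv; have [v0 Hv0] := rv; split=> [[i [iD [e1 e2 e3]]]|].
  have iDE : iD = delta_current s v.
    apply/colP => k; rewrite delta_currentE // e2 mul_diagc_mx [conjv iD k 0]mxE.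
    by rewrite mulrAC divff // mul1r conjcK.
  have iE : i = star_current s v + H^T *m iD.
    apply/colP => k; have := congr1 (fun x : vec => x k 0) e1.
    rewrite colDE !mul_diagc_mx HCtr_conj.
    rewrite [conjv i k 0]mxE [conjv (_ *m _) k 0]mxE => e.
    have eS : sY s k 0 = v k 0 * conjc (i k 0) - conjc ((H^T *m iD) k 0) * v k 0.
      by rewrite -e [RHS]addrC addKr.
    rewrite colDE star_currentE // eS mulrBl mulrAC divff // mul1r.
    rewrite mulfK // rmorphB /= !conjcK.
    by rewrite subrK.
  by rewrite GmapE -iDE -iE e3 zero_load_current mulKmx // addrC subrK.
move=> Gv; exists (YL0 net *m slack net + YLL net *m v), (delta_current s v).
split=> //.
  have vw : v - w = Yi *m (star_current s v + H^T *m delta_current s v).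
    by rewrite -{1}Gv GmapE addrAC subrr add0r.
  rewrite zero_load_current vw mulKVmx //.
  apply/colP => k; rewrite colDE !mul_diagc_mx HCtr_conj ![conjv _ k 0]mxE.
  rewrite colDE rmorphD /= star_currentE // conjcK mulrDr mulrCA divff //.
  by rewrite mulr1 addrC; congr (_ + _); rewrite mulrC.
apply/colP => k; rewrite mul_diagc_mx [conjv _ k 0]mxE delta_currentE // conjcK.
by rewrite mulrCA divff // mulr1.
Qed.

End Network.

(** * The Jacobian of the injection map *)

Section Jacobian.
Variables (R : realType) (N : nat) (net : network R N).
Local Notation vec := 'cV[R[i]]_(3 * N).
Local Notation state := 'rV[R]_((3 * N + 3 * N) + (3 * N + 3 * N)).
Let H := HC R N.
Implicit Types (v iD dv dI : vec) (y e : state) (t : R).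

(** The differential of [inj_Y] at [(v, iD)] in the direction [(dv, dI)]. *)
Definition dinj_Y v iD dv dI : vec :=
  diagc dv *m conjv (YL0 net *m slack net + YLL net *m v)
  + diagc v *m conjv (YLL net *m dv)
  - diagc (H^T *m conjv dI) *m v - diagc (H^T *m conjv iD) *m dv.

Definition dinj_D v iD dv dI : vec :=
  diagc (H *m dv) *m conjv iD + diagc (H *m v) *m conjv dI.

(** The second-order part of [inj_Y], independent of the base point. *)
Definition qinj_Y dv dI : vec :=
  diagc dv *m conjv (YLL net *m dv) - diagc (H^T *m conjv dI) *m dv.

Definition qinj_D dv dI : vec := diagc (H *m dv) *m conjv dI.

Definition dhmap y e : state :=
  let v := complexify (lsubmx y) in let iD := complexify (rsubmx y) in
  let dv := complexify (lsubmx e) in let dI := complexify (rsubmx e) in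
  realify (dinj_Y v iD dv dI) (dinj_D v iD dv dI).

Definition qhmap e : state :=
  let dv := complexify (lsubmx e) in let dI := complexify (rsubmx e) in
  realify (qinj_Y dv dI) (qinj_D dv dI).

Lemma complexifyK n : cancel (fun a : 'cV[R[i]]_n =>
  row_mx (map_mx (@complex.Re R) a)^T (map_mx (@complex.Im R) a)^T) (@complexify R n).
Proof.
move=> a; apply/colP => j; rewrite mxE row_mxKl row_mxKr !mxE.
by case: (a j 0).
Qed.

Lemma lrealifyK n (a b : 'cV[R[i]]_n) : complexify (lsubmx (realify a b)) = a.
Proof. by rewrite row_mxKl complexifyK. Qed.

Lemma rrealifyK n (a b : 'cV[R[i]]_n) : complexify (rsubmx (realify a b)) = b.
Proof. by rewrite row_mxKr complexifyK. Qed.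

Lemma complexify_eq0 n (x : 'rV[R]_(n + n)) : complexify x = 0 -> x = 0.
Proof.
move=> x0.
have x0j j : lsubmx x 0 j = 0 /\ rsubmx x 0 j = 0.
  by have := congr1 (fun z : 'cV[R[i]]_n => z j 0) x0; rewrite !mxE => -[-> ->].
have l0 : lsubmx x = 0 by apply/rowP => j; rewrite (x0j j).1 mxE.
have r0 : rsubmx x = 0 by apply/rowP => j; rewrite (x0j j).2 mxE.
by rewrite -[x]hsubmxK l0 r0 row_mx0.
Qed.

Lemma complexify_linear n t (x e : 'rV[R]_(n + n)) :
  complexify (t *: e + x) = real_complex R t *: complexify e + complexify x.
Proof.
apply/colP => j; rewrite !mxE; apply/eqP.
by rewrite eq_complex /= !mul0r subr0 addr0 !eqxx.
Qed.

Lemma realify_linear n t (a b a' b' : 'cV[R[i]]_n) :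
  realify (real_complex R t *: a + a') (real_complex R t *: b + b') =
  t *: realify a b + realify a' b'.
Proof.
rewrite /realify !scale_row_mx !add_row_mx; congr row_mx; congr row_mx;
apply/rowP => j; rewrite !mxE.
- by case: (a j 0) => ? ?; case: (a' j 0) => ? ? /=; rewrite mul0r subr0.
- by case: (a j 0) => ? ?; case: (a' j 0) => ? ? /=; rewrite mul0r addr0.
- by case: (b j 0) => ? ?; case: (b' j 0) => ? ? /=; rewrite mul0r subr0.
- by case: (b j 0) => ? ?; case: (b' j 0) => ? ? /=; rewrite mul0r addr0.
Qed.

(** Conjugation is linear over the reals only, which is why the scalars below are of the form
    [real_complex R t]. *)
Lemma conjv_linear n t (a b : 'cV[R[i]]_n) :
  conjv (real_complex R t *: a + b) = real_complex R t *: conjv a + conjv b.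
Proof.
apply/colP => j; rewrite !mxE rmorphD rmorphM /=; congr (_ * _ + _).
exact: conjc_real.
Qed.

Lemma diagc_linear n (z : R[i]) (a b : 'cV[R[i]]_n) :
  diagc (z *: a + b) = z *: diagc a + diagc b.
Proof. by rewrite /diagc !linearP. Qed.

Lemma diagc_mul_expand n (z : R[i]) (a a' b b' : 'cV[R[i]]_n) :
  diagc (z *: a' + a) *m (z *: b' + b) =
  z *: (z *: (diagc a' *m b') + (diagc a' *m b + diagc a *m b')) + diagc a *m b.
Proof.
rewrite diagc_linear mulmxDl -scalemxAl !mulmxDr -!scalemxAr addrA !scalerDr.
by rewrite !addrA.
Qed.

Lemma inj_Y_expand v iD dv dI t :
  let z := real_complex R t in
  inj_Y net (z *: dv + v) (z *: dI + iD) =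
  z *: (z *: qinj_Y dv dI + dinj_Y v iD dv dI) + inj_Y net v iD.
Proof.
move=> z.
have YE : YL0 net *m slack net + YLL net *m (z *: dv + v) =
    z *: (YLL net *m dv) + (YL0 net *m slack net + YLL net *m v).
  by rewrite mulmxDr -scalemxAr addrCA.
rewrite /inj_Y YE !conjv_linear [_^T *m (_ + _)]mulmxDr -scalemxAr
  !diagc_mul_expand.
rewrite /qinj_Y /dinj_Y.
rewrite opprD addrACA; congr (_ + _).
rewrite -scalerBr opprD addrACA -scalerBr; congr (z *: (_ + _)).
by rewrite opprD addrA.
Qed.

Lemma inj_D_expand v iD dv dI t :
  let z := real_complex R t in
  inj_D (z *: dv + v) (z *: dI + iD) =
  z *: (z *: qinj_D dv dI + dinj_D v iD dv dI) + inj_D v iD.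
Proof.
by move=> z; rewrite /inj_D conjv_linear [HC R N *m (_ + _)]mulmxDr -scalemxAr
  diagc_mul_expand.
Qed.

(** The injections are quadratic in the real coordinates, so this Taylor expansion is exact; for [t]
    nonzero the difference quotient is [t *: qhmap e + dhmap y e]. *)
Lemma hmap_expand y e t :
  hmap net (t *: e + y) = t *: (t *: qhmap e + dhmap y e) + hmap net y.
Proof.
rewrite /hmap [lsubmx _]linearP [rsubmx _]linearP /=.
rewrite !complexify_linear inj_Y_expand inj_D_expand.
by rewrite !realify_linear.
Qed.

Lemma derive_hmap y e i : 'D_e (fun z => hmap net z 0 i) y = dhmap y e 0 i.
Proof.
apply: cvg_lim => //.
have cv : (fun h : R => h * qhmap e 0 i + dhmap y e 0 i) @ 0^' --> dhmap y e 0 i.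
  rewrite -[X in _ --> X]add0r -[X in _ --> X + _](mul0r (qhmap e 0 i)).
  apply: cvg_within_filter.
  by apply: cvgD; [apply: cvgMr_tmp; exact: cvg_id|exact: cvg_cst].
apply: cvg_trans cv; apply: near_eq_cvg; near=> h.
have h0 : h != 0 by near: h; exact: nbhs_dnbhs_neq.
have rowE (a b c : state) : (h *: (h *: a + b) + c) 0 i =
  h * (h * a 0 i + b 0 i) + c 0 i by rewrite !mxE.
move: (hmap net) (qhmap e) (dhmap y e) (hmap_expand y e h) => F q d E.
by rewrite /= E rowE addrK -[_ *: _]/(_ * _) mulKf.
Unshelve. all: by end_near. Qed.

Lemma diagc_mull n (z : R[i]) (a b c : 'cV[R[i]]_n) :
  diagc (z *: a + b) *m c = z *: (diagc a *m c) + diagc b *m c.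
Proof. by rewrite diagc_linear mulmxDl scalemxAl. Qed.

Lemma mulmx_linear m n p (z : R[i]) (A : 'M[R[i]]_(m, n)) (b c : 'M[R[i]]_(n, p)) :
  A *m (z *: b + c) = z *: (A *m b) + A *m c.
Proof. by rewrite mulmxDr scalemxAr. Qed.

Lemma dinj_Y_linear v iD dv dI dv' dI' t :
  let z := real_complex R t in
  dinj_Y v iD (z *: dv + dv') (z *: dI + dI') =
  z *: dinj_Y v iD dv dI + dinj_Y v iD dv' dI'.
Proof.
move=> z; rewrite /dinj_Y [YLL net *m (_ + _)]mulmxDr -scalemxAr !conjv_linear.
rewrite [_^T *m (_ + _)]mulmxDr -scalemxAr.
rewrite 2!diagc_mull.
move: (diagc v) (diagc (H^T *m conjv iD)) => V I.
move: (conjv _) (conjv _) (conjv _) (diagc _) (diagc _) => cv cdv cdv' dIm dIm'.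
rewrite (mulmx_linear z V) (mulmx_linear z I).
rewrite !scalerBr scalerDr !opprD [RHS]addrACA; congr (_ + _).
rewrite [RHS]addrACA; congr (_ + _).
by rewrite addrACA.
Qed.

Lemma dinj_D_linear v iD dv dI dv' dI' t :
  let z := real_complex R t in
  dinj_D v iD (z *: dv + dv') (z *: dI + dI') =
  z *: dinj_D v iD dv dI + dinj_D v iD dv' dI'.
Proof.
move=> z; rewrite /dinj_D [H *m (_ + _)]mulmxDr -scalemxAr conjv_linear.
rewrite diagc_linear mulmxDl mulmxDr -scalemxAl -scalemxAr scalerDr.
by rewrite addrACA.
Qed.

Lemma dhmap_linear y : linear (dhmap y).
Proof.
move=> t e e'; rewrite /dhmap [lsubmx (_ + _)]linearP [rsubmx (_ + _)]linearP /=.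
rewrite !complexify_linear dinj_Y_linear dinj_D_linear realify_linear //.
Qed.

HB.instance Definition _ y := GRing.isLinear.Build R state state *:%R (dhmap y)
  (dhmap_linear y).

(** The transpose appears because [lin1_mx] acts on row vectors, whereas column [j] of [Jmx] holds
    the derivatives along coordinate [j]. *)
Lemma Jmx_dhmap y : Jmx net y = (lin1_mx (dhmap y))^T.
Proof. by apply/matrixP => i j; rewrite mxE derive_hmap [RHS]mxE [RHS]mxE. Qed.

Lemma Jmx_unit y : (forall e, dhmap y e = 0 -> e = 0) -> Jmx net y \in unitmx.
Proof.
move=> inj; rewrite Jmx_dhmap unitmx_tr -row_free_unit.
by apply: inj_row_free => e; rewrite mul_rV_lin1; exact: inj.
Qed.

End Jacobian.

(** * Triviality of the kernel of the Jacobian *)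

Section NonSingular.
Variables (R : realType) (N : nat) (net : network R N).
Hypothesis hYLL : YLL net \in unitmx.
Hypothesis hw : forall j, zero_load net j 0 != 0.
Local Notation vec := 'cV[R[i]]_(3 * N).
Local Notation pow := 'cV[R[i]]_(3 * N + 3 * N).
Let w := zero_load net.
Let H := HC R N.
Implicit Types (v dv dI : vec) (s : pow) (m : R).

(** With the delta power held constant, [dI] is the differential of conj(s^Delta / (H v)) in the
    direction [dv]. *)
Lemma dinj_D_eq0 s v dv dI k : regular v ->
  dinj_D v (delta_current s v) dv dI = 0 ->
  dI k 0 = - conjc (sD s k 0 * (H *m dv) k 0 / ((H *m v) k 0) ^+ 2).
Proof.
move=> rv; have [_ Hv0] := rv.
move=> /(congr1 (fun x : vec => x k 0)); rewrite [RHS]mxE /dinj_D colDE !mul_diagc_mx.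
rewrite [conjv dI k 0]mxE [conjv _ k 0]mxE delta_currentE // conjcK -/H => e.
rewrite -[LHS]conjcK -rmorphN /=; congr conjc.
have /eqP := e; rewrite addrC addr_eq0 => /eqP e'.
apply: (mulfI (Hv0 k)); rewrite e'; field; exact: Hv0.
Qed.

(** At a solution the bus current is the star current plus H^T times the delta current; the delta
    contribution cancels against the term in [iD], leaving the differential of the star current. *)
Lemma dinj_Y_eq0 s v dv dI : regular v -> load_flow net s v ->
  dinj_Y net v (delta_current s v) dv dI = 0 ->
  YLL net *m dv = \col_k (- conjc (sY s k 0 * dv k 0 / (v k 0) ^+ 2)) + H^T *m dI.
Proof.
move=> rv lf; have [v0 _] := rv.
have /(load_flow_Gmap hYLL s rv) Gv := lf.
have iE : YL0 net *m slack net + YLL net *m v =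
    star_current s v + H^T *m delta_current s v.
  rewrite zero_load_current // -{1}Gv GmapE addrAC subrr add0r mulKVmx //.
move=> /(congr1 (fun x : vec => x _ 0)) e0; apply/colP => k.
have := e0 k; rewrite [RHS]mxE /dinj_Y iE !colBE colDE !mul_diagc_mx -/H.
rewrite !HCtr_conj ![conjv _ k 0]mxE !colDE rmorphD /= star_currentE // conjcK mxE.
set Hd := conjc ((_ *m delta_current s v) k 0).
set HI := (_ *m dI) k 0; set Yd := (YLL net *m dv) k 0 => e.
apply: (can_inj (@conjcK R)); rewrite rmorphD rmorphN /= conjcK.
apply: (mulfI (v0 k)).
rewrite mulrDr mulrN.
have -> : v k 0 * (sY s k 0 * dv k 0 / v k 0 ^+ 2) = dv k 0 * (sY s k 0 / v k 0).
  by field; exact: v0.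
apply/eqP; rewrite -subr_eq0 -e; apply/eqP; ring.
Qed.

Lemma kernel_eq0 s v m dv dI : 0 < m -> margin net m v -> load_flow net s v ->
  xi net s < m ^+ 2 ->
  dinj_Y net v (delta_current s v) dv dI = 0 ->
  dinj_D v (delta_current s v) dv dI = 0 ->
  dv = 0 /\ dI = 0.
Proof.
move=> m0 mv lf xim eY eD.
have rv := margin_regular hw m0 mv; have [v0 Hv0] := rv.
pose q := xi net s / m ^+ 2.
have q0 : 0 <= q by rewrite divr_ge0 ?xi_ge0 // sqr_ge0.
have q1 : q < 1 by rewrite ltr_pdivrMr ?exprn_gt0 // mul1r.
have key (p x y : R[i]) (z d : R) : 0 < z -> 0 <= d ->
    m * z <= cmod x -> cmod y <= d * z ->
    cmod (- conjc (p * y / x ^+ 2)) * z <= d / m ^+ 2 * cmod p.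
  move=> z0 d0 mx yz.
  have x0 : 0 < cmod x by rewrite (lt_le_trans _ mx) // mulr_gt0.
  rewrite cmodN cmod_conj !cmodM cmodV expr2 cmodM.
  have -> : cmod p * cmod y / (cmod x * cmod x) * z =
    cmod y * z / (cmod x * cmod x) * cmod p by ring.
  rewrite ler_wpM2r ?cmod_ge0 // ler_pdivrMr ?mulr_gt0 // mulrAC.
  rewrite ler_pdivlMr ?exprn_gt0 //.
  rewrite (le_trans (ler_wpM2r (ltW (exprn_gt0 2 m0)) (ler_wpM2r (ltW z0) yz))) //.
  have -> : d * z * z * m ^+ 2 = d * (m * z * (m * z)) by ring.
  by rewrite ler_wpM2l // ler_pM // mulr_ge0 // ltW.
have contract d : 0 <= d -> (forall j, cmod (dv j 0) <= d * cmod (w j 0)) ->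
    forall j, cmod (dv j 0) <= q * d * cmod (w j 0).
  move=> d0 dvd j.
  (* Applying Y_LL^{-1} makes [dv] its own image under the linearised map, which [xi_bound]
     controls. *)
  rewrite -[dv](mulKmx hYLL) (dinj_Y_eq0 rv lf eY).
  have -> : q * d * cmod (w j 0) = d / m ^+ 2 * xi net s * cmod (w j 0).
    by rewrite /q; ring.
  apply: xi_bound => // [|k|k].
  - by rewrite divr_ge0 ?sqr_ge0.
  - by rewrite mxE; apply: key => //; [rewrite cmod_gt0|case: mv].
  - rewrite (dinj_D_eq0 k rv eD); apply: key => //; first exact: Lw_gt0.
      by case: mv.
    exact: cmod_HC.
(* A sum of nonnegative ratios dominates each of them, so it serves as a first bound, which
   [contract] then improves indefinitely. *)
pose d := \sum_k cmod (dv k 0) / cmod (w k 0).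
have d0 : 0 <= d by apply: sumr_ge0 => k _; rewrite divr_ge0 ?cmod_ge0.
have dvd k j : cmod (dv j 0) <= q ^+ k * d * cmod (w j 0).
  elim: k j => [|k IH] j; last first.
    by rewrite exprS -(mulrA q); apply: contract => //; rewrite mulr_ge0 // exprn_ge0.
  rewrite mul1r -ler_pdivrMr ?cmod_gt0 // /d (bigD1 j) //= lerDl.
  by apply: sumr_ge0 => i _; rewrite divr_ge0 ?cmod_ge0.
have dv0 : dv = 0.
  apply/colP => j; apply/eqP; rewrite mxE -cmod_eq0 eq_le cmod_ge0 andbT.
  apply: (@geometric_bound_le0 _ q (d * cmod (w j 0))) => // k.
  by rewrite mulrC mulrA.
split=> //; apply/colP => k; rewrite (dinj_D_eq0 k rv eD) dv0 mulmx0 !mxE.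
by rewrite mulr0 mul0r conjc0 oppr0.
Qed.

Lemma nonsingular_of_xi s v : load_flow net s v -> 0 < gamma net v ->
  xi net s < gamma net v ^+ 2 -> nonsingular net v s.
Proof.
move=> lf g0 xig.
have mv := gamma_margin hw v; have rv := margin_regular hw g0 mv.
split=> //; first exact: rv.2.
apply: Jmx_unit => e.
rewrite /dhmap lrealifyK rrealifyK.
set dv := complexify (lsubmx e); set dI := complexify (rsubmx e) => h0.
have eY := congr1 (fun y => complexify (lsubmx y)) h0.
have eD := congr1 (fun y => complexify (rsubmx y)) h0.
have c0 n : complexify (0 : 'rV[R]_(n + n)) = 0.
  by apply/colP => j; rewrite !mxE.
rewrite /= lrealifyK [lsubmx 0]linear0 c0 in eY.
rewrite /= rrealifyK [rsubmx 0]linear0 c0 in eD.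
have [/complexify_eq0 l0 /complexify_eq0 r0] := kernel_eq0 g0 mv lf xig eY eD.
by rewrite -[e]hsubmxK l0 r0 row_mx0.
Qed.

End NonSingular.

(** Here [x] and [d] stand for xi(shat) and xi(s - shat), [a] and [b] for the two radii. Solving the
    definition of [a] for [x] gives x = g^2 - 2 a g, so 0 <= x means a <= g/2; with the root named
    [S], all the claims become polynomial. *)
Lemma radii_bounds (R : realType) (g x d : R) :
  let a := 1 / 2 * ((g ^+ 2 - x) / g) in
  let b := a - Num.sqrt (a ^+ 2 - d) in
  0 < g -> 0 <= x -> x < g ^+ 2 -> 0 <= d -> d < 1 / 4 * ((g ^+ 2 - x) / g) ^+ 2 ->
  [/\ 0 < a < g, 0 <= b <= a, x + d < (g - a) ^+ 2,
      d + a / g * x <= a * (g - a) & d + b / g * x <= b * (g - b)].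
Proof.
move=> a b g0 x0 xg d0 da.
have xE : x = g ^+ 2 - 2 * a * g by rewrite /a; field; rewrite gt_eqF.
have {}da : d < a ^+ 2.
  by move: da; rewrite (_ : 1 / 4 * _ = a ^+ 2) // /a; field; rewrite gt_eqF.
have a0 : 0 < a by rewrite /a mulr_gt0 // divr_gt0 // subr_gt0.
rewrite {}/b; move: a a0 da xE => a a0 da xE; subst x.
have S0 := sqrtr_ge0 (a ^+ 2 - d).
have SE : Num.sqrt (a ^+ 2 - d) ^+ 2 = a ^+ 2 - d by rewrite sqr_sqrtr // subr_ge0 ltW.
move: (Num.sqrt _) S0 SE => S S0 SE.
(* For a radius [r] the last two conditions both read [(a - r)^2 <= S^2]. *)
have divE r : r / g * (g ^+ 2 - 2 * a * g) = r * (g - 2 * a).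
  by field; rewrite gt_eqF.
by rewrite !divE; split; [apply/andP; split|apply/andP; split| | |]; nra.
Qed.

(** * Invariant discs around [vhat] *)

Section Discs.
Variables (R : realType) (N : nat) (net : network R N).
Hypothesis hYLL : YLL net \in unitmx.
Hypothesis hw : forall j, zero_load net j 0 != 0.
Local Notation vec := 'cV[R[i]]_(3 * N).
Local Notation pow := 'cV[R[i]]_(3 * N + 3 * N).
Let w := zero_load net.
Variables (vhat : vec) (shat s : pow).
Let g := gamma net vhat.
Hypothesis g0 : 0 < g.
Hypothesis vhat_fix : Gmap net shat vhat = vhat.

Lemma disc_margin r v : disc net vhat r v -> margin net (g - r) v.
Proof. by move=> Dv; apply: margin_dist Dv; exact: gamma_margin. Qed.

(** Compare [Gmap net s v] with vhat = G_shat(vhat) through G_shat(v): the change of power costs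
    xi(s - shat)/(g - r), the change of voltage r xi(shat)/((g - r) g). *)
Lemma Gmap_disc r v : 0 <= r -> r < g ->
  xi net (s - shat) + r / g * xi net shat <= r * (g - r) ->
  disc net vhat r v -> disc net vhat r (Gmap net s v).
Proof.
move=> r0 rg hr Dv j; have gr : 0 < g - r by rewrite subr_gt0.
have mv := disc_margin Dv.
have h1 := Gmap_perturb hw s shat gr mv j.
have h2 := Gmap_lip hw shat gr g0 mv (gamma_margin hw vhat) r0 Dv j.
rewrite -{1}vhat_fix (le_trans (cmod_dist (Gmap net shat v j 0) _ _)) //.
rewrite (le_trans (lerD h1 h2)) // -mulrDl ler_wpM2r ?cmod_ge0 //.
have sumE (a b x y : R) : 0 < a -> 0 < b ->
    a^-1 * x + r / (a * b) * y = (x + r / b * y) / a.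
  by move=> a0 b0; field; rewrite !gt_eqF.
by rewrite sumE // ler_pdivrMr.
Qed.

(** Meant for both radii; [r = 0] must be allowed because the smaller one vanishes when xi(s - shat)
    = 0. *)
Lemma disc_fixpoint r : 0 <= r -> r < g ->
  xi net (s - shat) + r / g * xi net shat <= r * (g - r) ->
  xi net s < (g - r) ^+ 2 ->
  exists v, [/\ disc net vhat r v, Gmap net s v = v &
    exists q (C : 'I_(3 * N) -> R), [/\ 0 <= q, q < 1 &
      forall u, disc net vhat r u -> forall k j,
        cmod (iter k (Gmap net s) u j 0 - v j 0) <= C j * q ^+ k]].
Proof.
move=> r0 rg hr xs; have gr : 0 < g - r by rewrite subr_gt0.
pose q := xi net s / (g - r) ^+ 2.
have q0 : 0 <= q by rewrite divr_ge0 ?xi_ge0 ?sqr_ge0.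
have q1 : q < 1 by rewrite ltr_pdivrMr ?exprn_gt0 // mul1r.
have [|||v [Dv Fv cv]] := @weighted_banach R (3 * N) (fun j => cmod (w j 0)) vhat r q
  (Gmap net s) r0 _ q0 q1.
- by move=> j; exact: cmod_ge0.
- by move=> v; exact: Gmap_disc.
- move=> u v d /disc_margin mu /disc_margin mv d0 uv j.
  rewrite (le_trans (Gmap_lip hw s gr gr mu mv d0 uv j)) //.
  by rewrite le_eqVlt /q expr2; apply/orP; left; apply/eqP; ring.
exists v; split=> //; exists q, (fun j => 2 * r * cmod (w j 0)); split=> //.
Qed.

End Discs.

(** * Existence, uniqueness, iteration, location and non-singularity *)

Theorem theorem2 (R : realType) (N : nat) (hN : (0 < N)%N) (net : network R N)
    (hYLL : YLL net \in unitmx)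
    (hw : forall j : 'I_(3 * N), zero_load net j 0 != 0)
    (vhat : 'cV[R[i]]_(3 * N)) (shat s : 'cV[R[i]]_(3 * N + 3 * N))
    (hvhat : load_flow net shat vhat)
    (hxi : xi net shat < gamma net vhat ^+ 2)
    (hs : xi net (s - shat)
          < 1 / 4 * ((gamma net vhat ^+ 2 - xi net shat) / gamma net vhat) ^+ 2) :
  let rho2 : R := 1 / 2 * ((gamma net vhat ^+ 2 - xi net shat) / gamma net vhat) in
  let rho1 : R := rho2 - Num.sqrt (rho2 ^+ 2 - xi net (s - shat)) in
  nonsingular net vhat shat /\
  exists v : 'cV[R[i]]_(3 * N),
    (disc net vhat rho2 v /\ load_flow net s v) /\
    (forall v' : 'cV[R[i]]_(3 * N),
        disc net vhat rho2 v' -> load_flow net s v' -> v' = v) /\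
    (forall u : 'cV[R[i]]_(3 * N), disc net vhat rho2 u ->
        (forall k : nat, regular (iter k (Gmap net s) u)) /\
        cvgv (fun k : nat => iter k (Gmap net s) u) v) /\
    disc net vhat rho1 v /\
    xi net s < gamma net v ^+ 2 /\
    nonsingular net v s.
Proof.
move=> rho2 rho1.
have x0 := xi_ge0 net shat; have dx0 := xi_ge0 net (s - shat).
(* A minimum of nonnegative ratios is nonnegative, and it cannot vanish since 0 <= xi(shat) <
   gamma(vhat)^2. *)
have g0 : 0 < gamma net vhat.
  have ge0 : 0 <= gamma net vhat.
    by apply: le_gamma => //; split=> j; rewrite mul0r cmod_ge0.
  by rewrite lt_neqAle ge0 andbT eq_sym -sqrf_eq0 gt_eqF // (le_lt_trans x0).
have ns : nonsingular net vhat shat by exact: nonsingular_of_xi.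
have vhat_fix : Gmap net shat vhat = vhat.
  have rhat := margin_regular hw g0 (gamma_margin hw vhat).
  exact: (load_flow_Gmap hYLL shat rhat).1.
have [/andP[r20 r2g] /andP[r10 r12] xs stable2 stable1] := radii_bounds g0 x0 hxi dx0 hs.
rewrite -/rho2 -/rho1 in r20 r2g r10 r12 xs stable2 stable1.
have r1g := le_lt_trans r12 r2g.
have {}xs : xi net s < (gamma net vhat - rho2) ^+ 2.
  by have := xi_triangle net shat (s - shat); rewrite addrC subrK => /le_lt_trans; apply.
have xs1 : xi net s < (gamma net vhat - rho1) ^+ 2.
  by rewrite (lt_le_trans xs) // ler_sqr ?nnegrE ?subr_ge0 ?(ltW r2g) ?(ltW r1g) // lerB.
have [v [Dv Fv [q [C [q0 q1 cv]]]]] :=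
  disc_fixpoint hw g0 vhat_fix (ltW r20) r2g stable2 xs.
(* A second fixed point, in the smaller disc; as rho1 <= rho2, uniqueness in the larger disc
   identifies it with [v], which locates [v]. *)
have [v1 [Dv1 Fv1 _]] := disc_fixpoint hw g0 vhat_fix r10 r1g stable1 xs1.
have disc_regular u : disc net vhat rho2 u -> regular u.
  move=> Du; apply: (margin_regular hw _ (disc_margin hw Du)).
  by rewrite subr_gt0.
(* The orbit of a fixed point is constant, yet it converges to [v] at a geometric rate. *)
have uniq v' : disc net vhat rho2 v' -> Gmap net s v' = v' -> v' = v.
  move=> Dv' Fv'; apply/colP => j; apply/eqP.
  rewrite -subr_eq0 -cmod_eq0 eq_le cmod_ge0 andbT.
  apply: (@geometric_bound_le0 _ q (C j)) => // k.
  by have := cv v' Dv' k j; rewrite iter_fix.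
have v1v : v1 = v.
  apply: uniq => // j; rewrite (le_trans (Dv1 j)) // ler_wpM2r ?cmod_ge0 //.
have lf : load_flow net s v by exact: (load_flow_Gmap hYLL s (disc_regular _ Dv)).2.
(* Membership in the disc of radius [rho2] transfers the contraction bound xi(s) < (g - rho2)^2 to
   gamma(v)^2. *)
have mg : gamma net vhat - rho2 <= gamma net v.
  by apply: le_gamma => //; exact: disc_margin.
have xsv : xi net s < gamma net v ^+ 2.
  rewrite (lt_le_trans xs) // ler_sqr // nnegrE ?subr_ge0 ?(ltW r2g) //.
  by rewrite (le_trans _ mg) // subr_ge0 ltW.
have g0v : 0 < gamma net v by rewrite (lt_le_trans _ mg) // subr_gt0.
split; first exact: ns.
exists v; split; first by split.
split=> [v' Dv' lf'|].
  exact: uniq Dv' ((load_flow_Gmap hYLL s (disc_regular _ Dv')).1 lf').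
split=> [u Du|].
  split=> [k|]; last exact: geometric_cvgv q0 q1 (cv u Du).
  apply: disc_regular; elim: k => [|k IH]; first exact: Du.
  rewrite iterS; exact: (Gmap_disc hw g0 vhat_fix (ltW r20) r2g stable2 IH).
split; first by rewrite -v1v.
split; first exact: xsv.
exact: nonsingular_of_xi lf g0v xsv.
Qed.
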